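(* Let $m\ge 2$ and $j\ge 1$ be integers, let $i=j+m-1$, let $u\in\mathbb{Z}$, and let $d_1=2^{i-1}-2^{j-1}+u(2^m+1)$. Assume $\gcd(d_1,2^{2m}-1)=1$ and $\gcd(2^i-2^j,2^m+1)=1$. Let $U=\{x\in\mathbb{F}_{2^{2m}}: x^{2^m+1}=1\}$ and define $g:U\to U$ by $g(x)=x^{d_1}\bigl(1+x^{-2^{j-1}}+x^{2^{i-1}}\bigr)^{2^m-1}$. Let $r_1,r_2$ be integers with $r_1\cdot 2^{m-1}\equiv 1 \pmod{2^m+1}$ and $r_2\cdot 2^{j-1}\equiv 1\pmod{2^m+1}$. Then the compositional inverse of $g$ on $U$ is $g^{-1}(x)=x^{r_1r_2}$.
   Context: $U$ is the cyclic subgroup of order $2^m+1$ of the multiplicative group of $\mathbb{F}_{2^{2m}}$; negative integer powers of elements of $U$ are the usual group inverses. The hypotheses are those under which $x^{d_1}+x^{d_2}+x^{d_3}$, with $d_2=2^{i-1}+2^{j-1}+(u-2^{j-1})(2^{m}+1)$ and $d_3=-(2^{i-1}+2^{j-1})+(u+2^{i-1})(2^{m}+1)$, is a permutation trinomial of $\mathbb{F}_{2^{2m}}$ of the form $x^{d_1}(1+(x^{2^m-1})^{-2^{j-1}}+(x^{2^m-1})^{2^{i-1}})$, and $g$ is its associated map on $U$. *)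

(* Defs.v *)
From mathcomp Require Import all_boot all_order all_algebra.

Set Implicit Arguments.
Unset Strict Implicit.
Unset Printing Implicit Defensive.

Import GRing.Theory.
Local Open Scope ring_scope.

Definition unit_circle (F : finFieldType) (m : nat) : {set F} :=
  [set x : F | x ^+ (2 ^ m + 1)%N == 1].

(* All subtractions of natural numbers below occur with i, j >= 1, so they are
   not truncated. *)
Definition d1 (m i j : nat) (u : int) : int :=
  2%:Z ^+ (i - 1)%N - 2%:Z ^+ (j - 1)%N + u * (2%:Z ^+ m + 1).

(* Defined on all of F, because the trinomial is a sum taken in F; only its
   values on [unit_circle F m] matter. The powers with exponents in int are
   [exprz], which inverts the base when the exponent is negative. *)
Definition g_map (F : finFieldType) (m i j : nat) (u : int) (x : F) : F :=
  x ^ d1 m i j u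
  * (1 + x ^ (- 2%:Z ^+ (j - 1)%N) + x ^ (2%:Z ^+ (i - 1)%N)) ^+ (2 ^ m - 1)%N.

Definition comp_inverse_on (T : finType) (S : {set T}) (f h : T -> T) : Prop :=
  [/\ {in S, forall x, f x \in S},
      {in S, forall x, h x \in S},
      {in S, cancel f h} &
      {in S, cancel h f}].

(* Main.v *)
Require Import Defs.
From mathcomp Require Import all_boot all_order all_algebra all_field.
From mathcomp Require Import zify ring.

(** Put [q = 2 ^ m] and [y = x ^ (2 ^ (i - 1))] for [x] in [U].  Since
    [2 ^ i = 2 ^ (j - 1) * q] and [x ^ q = x^-1], we get
    [y ^ 2 = x ^ (- 2 ^ (j - 1))], so the trinomial is [w = 1 + y + y ^ 2] and
    [w ^ q = 1 + y^-1 + y ^ -2 = w / y ^ 2].  If [w] is nonzero then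
    [w ^ (q - 1) = y ^ -2], and [g x] collapses to [y], that is to
    [x ^ (2 ^ (m - 1) * 2 ^ (j - 1))], which [r1 * r2] inverts modulo [q + 1].
    If [w = 0] then [y ^ 3 = 1], so [y ^ q = y^-1 = y ^ 2] and, Frobenius being
    injective, [y ^ (2 ^ (m - 1)) = y]; hence [y ^ (2 ^ i - 2 ^ j) = 1], and the
    second coprimality hypothesis forces [y = 1], where [w = 1]. *)

Set Implicit Arguments.
Unset Strict Implicit.

Import GRing.Theory.
Local Open Scope ring_scope.

Lemma PoszX (n k : nat) : Posz (n ^ k)%N = n%:Z ^+ k.
Proof. by rewrite -!natz natrX. Qed.

Lemma exprz_eq_mod (F : fieldType) (x : F) (n a b : int) :
  x != 0 -> x ^ n = 1 -> (a = b %[mod n])%Z -> x ^ a = x ^ b.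
Proof.
move=> x0 xn /eqP; rewrite eqz_mod_dvd => /dvdzP[k ab].
by rewrite -(subrK b a) ab mulrC expfzDr// -exprz_exp xn exp1rz mul1r.
Qed.

(** Bezout coefficients [c], [d] write [x] as a product of a power of [x ^ a] and a power of
    [x ^ b]. *)
Lemma exprz_coprime_eq1 (F : fieldType) (x : F) (a b : int) :
  x != 0 -> coprimez a b -> x ^ a = 1 -> x ^ b = 1 -> x = 1.
Proof.
move=> x0 /coprimezP[[c d] /= cd] xa xb.
by rewrite -[x]expr1z -cd expfzDr// ![_ * a]mulrC ![_ * b]mulrC
  -!exprz_exp xa xb !exp1rz mulr1.
Qed.

Lemma unit_circle_neq0 (F : finFieldType) (m : nat) (x : F) :
  x \in unit_circle F m -> x != 0.
Proof.
by rewrite inE; apply: contraTneq => ->; rewrite addn1 expr0n eq_sym oner_eq0.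
Qed.

Lemma unit_circle_expz1 (F : finFieldType) (m : nat) (x : F) :
  x \in unit_circle F m -> x ^ (2%:Z ^+ m + 1) = 1.
Proof. by rewrite inE exprnP PoszD PoszX => /eqP. Qed.

Lemma unit_circle_expq (F : finFieldType) (m : nat) (x : F) :
  x \in unit_circle F m -> x ^+ (2 ^ m) = x^-1.
Proof.
move=> xU; have x0 := unit_circle_neq0 xU; apply: (mulIf x0).
by rewrite mulVf// -exprSr -addn1; move: xU; rewrite inE => /eqP.
Qed.

Lemma unit_circle_expz (F : finFieldType) (m : nat) (x : F) (k : int) :
  x \in unit_circle F m -> x ^ k \in unit_circle F m.
Proof.
move=> xU; rewrite inE exprnP exprzAC -exprnP.
by move: xU; rewrite inE => /eqP ->; rewrite exp1rz.
Qed.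

Lemma trinomial_neq0 (F : finFieldType) (m j : nat) (y : F) :
  2 \in [pchar F] -> (0 < m)%N ->
  coprimez (2%:Z ^+ (j + m - 1)%N - 2%:Z ^+ j) (2%:Z ^+ m + 1) ->
  y \in unit_circle F m -> 1 + y + y ^+ 2 != 0.
Proof.
move=> char2 m_gt0 cop yU; apply/eqP => w0.
have y0 := unit_circle_neq0 yU.
have y3 : y ^+ 3 = 1.
  by apply/eqP; rewrite -subr_eq0; apply/eqP;
    transitivity ((y - 1) * (1 + y + y ^+ 2)); [ring | rewrite w0 mulr0].
have yq1 : y ^+ (2 ^ m.-1) = y.
  apply: (fmorph_inj (pFrobenius_aut char2)).
  rewrite /= !pFrobenius_autE -exprM mulnC -expnS prednK//.
  by rewrite (unit_circle_expq yU); apply: (mulIf y0); rewrite mulVf// -exprSr.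
(* Since [j + m - 1 = m.-1 + j], the first power is [(y ^+ (2 ^ m.-1)) ^+ (2 ^ j)], and [yq1]
   removes the inner exponent. *)
have yij : y ^ (2%:Z ^+ (j + m - 1)%N - 2%:Z ^+ j) = 1.
  rewrite expfzDr// -invr_expz.
  have -> : y ^ (2%:Z ^+ (j + m - 1)%N) = y ^ (2%:Z ^+ j).
    rewrite -!PoszX -!exprnP.
    by rewrite (_ : j + m - 1 = m.-1 + j)%N ?expnD ?exprM ?yq1//; lia.
  by rewrite mulfV// expfz_neq0.
have y1 := exprz_coprime_eq1 y0 cop yij (unit_circle_expz1 yU).
move: w0; rewrite y1 expr1n (addrr_pchar2 char2) add0r => /eqP.
by rewrite oner_eq0.
Qed.

Lemma g_map_exp (F : finFieldType) (m i j : nat) (u : int) (x : F) :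
  2 \in [pchar F] -> (0 < m)%N -> (0 < j)%N -> i = (j + m - 1)%N ->
  coprimez (2%:Z ^+ i - 2%:Z ^+ j) (2%:Z ^+ m + 1) ->
  x \in unit_circle F m -> g_map m i j u x = x ^ (2%:Z ^+ (i - 1)%N).
Proof.
move=> char2 m_gt0 j_gt0 def_i cop xU; rewrite /g_map /d1.
have x0 := unit_circle_neq0 xU; have xq := unit_circle_expz1 xU.
set a := 2%:Z ^+ (i - 1)%N; set b := 2%:Z ^+ (j - 1)%N.
(* From [a * 2 = b * 2 ^+ m] it follows that [- b - a * 2 = - b * (2 ^+ m + 1)], which gives the
   witness [- b]. *)
have y2 : x ^ (- b) = (x ^ a) ^+ 2.
  have -> : (x ^ a) ^+ 2 = x ^ (a * 2) by rewrite -exprz_exp.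
  apply: (exprz_eq_mod x0 xq); apply/eqP; rewrite eqz_mod_dvd.
  apply/dvdzP; exists (- b).
  suff -> : a * 2 = b * 2 ^+ m by ring.
  by rewrite /a /b -exprSr -exprD; congr (_ ^+ _); lia.
have yU := unit_circle_expz a xU.
have y0 := unit_circle_neq0 yU; have yq := unit_circle_expq yU.
(* The multiple of [2 ^+ m + 1] drops out on the unit circle; by [y2] the factor for [- b]
   contributes two more copies of [x ^ a]. *)
have xd : x ^ (a - b + u * (2%:Z ^+ m + 1)) = (x ^ a) ^+ 3.
  rewrite expfzDr// [u * _]mulrC -exprz_exp xq exp1rz mulr1 expfzDr// y2.
  by rewrite -exprS.
rewrite xd y2; move: (x ^ a) yU y0 yq => y yU y0 yq.
have w0 : 1 + y + y ^+ 2 != 0.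
  by move: cop; rewrite def_i => /(trinomial_neq0 char2 m_gt0); apply.
rewrite addrAC; set w := 1 + y + y ^+ 2 in w0 *.
(* The power map is additive here and inverts [y]; multiplying by [y ^+ 2] then reverses the
   coefficients of the palindromic [w]. *)
have wq : w ^+ (2 ^ m) * y ^+ 2 = w.
  have p2 : [pchar F].-nat (2 ^ m)%N by rewrite pnatX pnatE ?char2.
  by rewrite /w !exprDn_pchar// expr1n exprAC yq; field.
(* Multiplying by [w] turns [w ^+ (2 ^ m - 1)] into [w ^+ (2 ^ m)], so that [wq] applies. *)
apply: (mulIf w0); rewrite -mulrA -exprSr subn1 prednK ?expn_gt0//.
by rewrite exprS -mulrA [_ * _ ^+ (2 ^ m)]mulrC wq.
Qed.

Theorem theorem3p4 (m i j : nat) (u : int) (F : finFieldType)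
    (m_ge2 : (2 <= m)%N) (j_ge1 : (1 <= j)%N) (def_i : i = (j + m - 1)%N)
    (cardF : #|F| = (2 ^ (2 * m))%N)
    (gcd_d1 : gcdz (d1 m i j u) (2%:Z ^+ (2 * m)%N - 1) = 1)
    (gcd_ij : gcdz (2%:Z ^+ i - 2%:Z ^+ j) (2%:Z ^+ m + 1) = 1)
    (r1 r2 : int)
    (r1P : (r1 * 2%:Z ^+ (m - 1)%N = 1 %[mod 2%:Z ^+ m + 1])%Z)
    (r2P : (r2 * 2%:Z ^+ (j - 1)%N = 1 %[mod 2%:Z ^+ m + 1])%Z) :
  comp_inverse_on (unit_circle F m) (@g_map F m i j u)
    (fun x : F => x ^ (r1 * r2)).
Proof.
have char2 : 2 \in [pchar F] by apply: card_finPcharP cardF _.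
have cop : coprimez (2%:Z ^+ i - 2%:Z ^+ j) (2%:Z ^+ m + 1).
  by apply/eqP.
have gE x : x \in unit_circle F m -> g_map m i j u x = x ^ (2%:Z ^+ (i - 1)%N).
  by apply: g_map_exp => //; apply: ltnW.
have inv x : x \in unit_circle F m -> x ^ (2%:Z ^+ (i - 1)%N * (r1 * r2)) = x.
  move=> xU; rewrite -[RHS]expr1z.
  apply: (exprz_eq_mod (unit_circle_neq0 xU) (unit_circle_expz1 xU)).
  (* As [i - 1 = (m - 1) + (j - 1)], the exponent splits into two factors, each congruent to 1. *)
  have -> : 2%:Z ^+ (i - 1)%N * (r1 * r2) =
      (r1 * 2%:Z ^+ (m - 1)%N) * (r2 * 2%:Z ^+ (j - 1)%N).
    have -> : (i - 1 = (m - 1) + (j - 1))%N by lia.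
    by rewrite exprD; ring.
  by rewrite -modzMml r1P modzMml mul1r r2P.
split=> x xU.
- by rewrite gE// unit_circle_expz.
- exact: unit_circle_expz.
(* On the unit circle both maps are power maps, so [inv] settles both orders of composition. *)
- by rewrite gE// exprz_exp inv.
- by rewrite gE ?unit_circle_expz// exprz_exp mulrC inv.
Qed.
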